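(* Let $G$ be a graph and $M\subseteq V(G)$ a connected module of $G$. Then $M$ is a module of every minimum interval supergraph of $G$.
   Context: Graphs are finite, simple, undirected. A set $M\subseteq V(G)$ is a module of $G$ if every vertex outside $M$ is adjacent either to all vertices of $M$ or to none of them; it is a connected module if moreover $G[M]$ is connected. An interval supergraph of $G$ is an interval graph $\widehat G$ with $V(\widehat G)=V(G)$ and $E(G)\subseteq E(\widehat G)$; it is minimum if it has the minimum number of edges among all interval supergraphs of $G$. *)

(* Defs.v *)
From mathcomp Require Import all_boot all_order all_algebra.
From mathcomp Require Import reals.

Set Implicit Arguments.
Unset Strict Implicit.
Unset Printing Implicit Defensive.

Local Open Scope ring_scope.

Record sgraph (T : finType) := SGraph {
  adj :> rel T;
  adj_sym : symmetric adj;
  adj_irr : irreflexive adj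
}.

Definition edges (T : finType) (G : sgraph T) : {set {set T}} :=
  [set [set p.1; p.2] | p in [set p : T * T | G p.1 p.2]].

Definition is_module (T : finType) (G : sgraph T) (M : {set T}) : Prop :=
  forall v, v \notin M ->
    (forall x, x \in M -> G v x) \/ (forall x, x \in M -> ~~ G v x).

Definition induced_rel (T : finType) (G : sgraph T) (M : {set T}) : rel T :=
  [rel x y | [&& x \in M, y \in M & G x y]].

(* Under this definition the empty set is connected. *)
Definition induces_connected (T : finType) (G : sgraph T) (M : {set T}) : Prop :=
  forall x y, x \in M -> y \in M -> connect (induced_rel G M) x y.

Definition connected_module (T : finType) (G : sgraph T) (M : {set T}) : Prop :=
  is_module G M /\ induces_connected G M.

(* G is the intersection graph of nonempty closed intervals [l v, r v] of the
   real line. *)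
Definition interval_graph (R : realType) (T : finType) (G : sgraph T) : Prop :=
  exists l r : T -> R,
    (forall v, l v <= r v) /\
    (forall u v, u != v ->
       (G u v <-> exists x : R, x \in `[l u, r u] /\ x \in `[l v, r v])).

Definition interval_supergraph (R : realType) (T : finType)
    (G H : sgraph T) : Prop :=
  interval_graph R H /\ edges G \subset edges H.

Definition minimum_interval_supergraph (R : realType) (T : finType)
    (G H : sgraph T) : Prop :=
  interval_supergraph R G H /\
  forall H' : sgraph T, interval_supergraph R G H' ->
    (#|edges H| <= #|edges H'|)%N.

(* Main.v *)
Require Import Defs.
From mathcomp Require Import all_boot all_order all_algebra.
From mathcomp Require Import reals lra.

(** Fix an interval representation [l, r] of [H], and let [s] and [t] have the
    greatest left endpoint and the least right endpoint in [M].  Every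
    [G]-neighbour [v] of [M] satisfies [l s <= r v] and [l v <= r t].  Suppose a
    set [C] contains these neighbours, and making [M] a module with
    neighbourhood [C], without changing [H[M]] or [H - M], leaves an interval
    graph.  If [C] has at most as many vertices outside [M] as each vertex of
    [M] has neighbours there, then minimality of [H] forces equality.

    If [l s <= r t], then [M] is a clique of [H] and all of its intervals can be
    shrunk to [[l s, r t]].  The intervals meeting this segment belong to
    neighbours of every vertex of [M], so equality makes [M] a module.

    If [r t < l s], choose [x] in [[r t, l s]] covered by the fewest intervals
    outside [M], cut the line at [x] and insert there a copy of the
    representation of [H[M]].  Equality and the choice of [x] show that the
    outer neighbours of [u] in [M] are exactly the outer vertices whose
    intervals cover a point of [[r t, l s]], for whichever such point the
    interval of [u] contains.  Two intersecting intervals of [M] share such a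
    point by Helly's property, hence have the same outer neighbours;
    connectivity of [M] finishes the proof. *)

Set Implicit Arguments.
Unset Strict Implicit.
Unset Printing Implicit Defensive.

Import Order.TTheory GRing.Theory Num.Theory.
Local Open Scope ring_scope.

(** * Edges and outer neighbourhoods *)

Section OuterNeighbourhood.
Variable T : finType.
Implicit Types (G H : sgraph T) (M C : {set T}) (u v : T).

Lemma eq_set2 u v x y :
  ([set u; v] == [set x; y]) = (u == x) && (v == y) || (u == y) && (v == x).
Proof.
apply/eqP/orP => [e | [] /andP[/eqP-> /eqP->] //]; last by rewrite setUC.
have := set21 u v; have := set22 u v; have := set21 x y; have := set22 x y.
rewrite -e {3 4}e !in_set2 ![x == _]eq_sym ![y == _]eq_sym.
by move: (u == x) (u == y) (v == x) (v == y) => [] [] [] [] //; auto.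
Qed.

Lemma edgesP G e :
  reflect (exists u v, G u v /\ e = [set u; v]) (e \in edges G).
Proof.
apply: (iffP imsetP) => [[[u v]] | [u [v [Guv ->]]]].
  by rewrite inE /=; exists u, v.
by exists (u, v); rewrite ?inE.
Qed.

Lemma mem_edges G u v : ([set u; v] \in edges G) = G u v.
Proof.
apply/edgesP/idP => [[x [y [Gxy /eqP]]] | Guv]; last by exists u, v.
by rewrite eq_set2 => /orP[] /andP[/eqP-> /eqP->] //; rewrite adj_sym.
Qed.

Lemma edges_subP G H : reflect (subrel G H) (edges G \subset edges H).
Proof.
apply: (iffP subsetP) => [sGH u v | sGH e].
  by rewrite -!mem_edges; apply: sGH.
by case/edgesP=> u [v [/sGH Huv ->]]; rewrite mem_edges.
Qed.

Definition outer_nbhd G M u : {set T} := [set v | (v \notin M) && G u v].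

Lemma is_moduleP G M :
  is_module G M <->
  {in M &, forall u v, outer_nbhd G M u = outer_nbhd G M v}.
Proof.
split=> [modM u w uM wM | eqN v vM].
  apply/setP => v; rewrite !inE; have [//|/modM] := boolP (v \in M).
  by rewrite ![G _ v]adj_sym => -[all|none];
    rewrite ?all // !(negbTE (none _ _)).
have [/exists_inP[u uM Gvu] | /exists_inPn noN] :=
  boolP [exists u in M, G v u]; last by right.
left=> w wM; have /setP/(_ v) := eqN u w uM wM.
by rewrite !inE vM ![G _ v]adj_sym Gvu /= => <-.
Qed.

Lemma induces_connected_const (A : eqType) G M (f : T -> A) :
  induces_connected G M -> {in M &, forall u v, G u v -> f u = f v} ->
  {in M &, forall u v, f u = f v}.
Proof.
move=> connM eqf u v uM vM; apply/eqP.
have clf : closed (induced_rel G M) [pred w | f u == f w].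
  by move=> w w' /and3P[wM w'M Gww']; rewrite !inE (eqf w w').
by have /esym := closed_connect clf (connM u v uM vM); rewrite !inE eqxx.
Qed.

Definition crosses M (e : {set T}) : bool :=
  ~~ (e \subset M) && ~~ [disjoint e & M].

Lemma crosses_set2 M u v : crosses M [set u; v] = (u \in M) (+) (v \in M).
Proof.
rewrite /crosses subUset !sub1set disjoints_subset subUset !sub1set !inE.
by case: (u \in M); case: (v \in M).
Qed.

Lemma card_crossing_edges G M :
  #|[set e in edges G | crosses M e]| = (\sum_(u in M) #|outer_nbhd G M u|)%N.
Proof.
pose arcs := [set p : T * T | [&& p.1 \in M, p.2 \notin M & G p.1 p.2]].
have -> : [set e in edges G | crosses M e] = [set [set p.1; p.2] | p in arcs].
  apply/setP=> e; rewrite inE; apply/andP/imsetP => [[]|[[u v]]].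
    case/edgesP=> u [v [Guv ->]]; rewrite crosses_set2.
    have [uM /= vM|uM /= vM] := boolP (u \in M).
      by exists (u, v); rewrite // inE /= uM vM.
    by exists (v, u); rewrite ?inE /= 1?setUC // vM uM adj_sym.
  rewrite inE /= => /and3P[uM vM Guv] ->.
  by rewrite mem_edges crosses_set2 uM (negbTE vM).
rewrite card_in_imset => [|[u v] [x y]]; last first.
  rewrite !inE /= => /and3P[uM vM _] /and3P[xM yM _] /eqP.
  rewrite eq_set2 => /orP[] /andP[/eqP-> /eqP ey]; first by rewrite ey.
  by rewrite ey xM in vM.
under eq_bigr do rewrite -sum1dep_card.
rewrite pair_big_dep -sum1_card; apply: eq_bigl => -[u v].
by rewrite inE.
Qed.

Lemma sym_crossing_ind M (P : T -> T -> Prop) :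
  (forall u v, P u v -> P v u) ->
  (forall u v, (u \in M) = (v \in M) -> P u v) ->
  {in M & ~: M, forall u v, P u v} -> forall u v, P u v.
Proof.
move=> symP sameP crossP u v.
have [uM|uM] := boolP (u \in M); have [vM|vM] := boolP (v \in M).
- by apply: sameP; rewrite uM vM.
- by apply: crossP; rewrite ?inE.
- by apply/symP/crossP; rewrite ?inE.
- by apply: sameP; rewrite (negbTE uM) (negbTE vM).
Qed.

(** * Reattaching a vertex set *)

Definition reattach_rel H M C : rel T := fun u v =>
  if u \in M then (if v \in M then H u v else v \in C)
  else if v \in M then u \in C else H u v.

Lemma reattach_sym H M C : symmetric (reattach_rel H M C).
Proof.
by move=> u v; rewrite /reattach_rel adj_sym; case: (u \in M); case: (v \in M).
Qed.

Lemma reattach_irr H M C : irreflexive (reattach_rel H M C).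
Proof. by move=> u; rewrite /reattach_rel adj_irr; case: (u \in M). Qed.

Definition reattach H M C := SGraph (reattach_sym H M C) (reattach_irr H M C).

Lemma reattach_same_side H M C u v :
  (u \in M) = (v \in M) -> reattach H M C u v = H u v.
Proof. by rewrite /= /reattach_rel => ->; case: (v \in M). Qed.

Lemma reattach_crossing H M C :
  {in M & ~: M, forall u v, reattach H M C u v = (v \in C)}.
Proof.
by move=> u v uM; rewrite inE /= /reattach_rel uM => /negbTE->.
Qed.

Lemma outer_nbhd_reattach H M C :
  {in M, forall u, outer_nbhd (reattach H M C) M u = C :\: M}.
Proof.
move=> u uM; apply/setP=> v; rewrite !inE.
by have [//|vM] := boolP (v \in M); rewrite reattach_crossing ?inE.
Qed.

Lemma subrel_reattach G H M C :
  subrel G H -> {in M, forall u, outer_nbhd G M u \subset C} ->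
  subrel G (reattach H M C).
Proof.
move=> sGH sNC.
apply: (@sym_crossing_ind M (fun u v => G u v -> reattach H M C u v)).
- by move=> u v; rewrite adj_sym [reattach _ _ _ v u]adj_sym.
- by move=> u v uv_side; rewrite reattach_same_side //; apply: sGH.
move=> u v uM vM Guv; rewrite reattach_crossing //.
by apply: (subsetP (sNC u uM)); rewrite inE Guv andbT -in_setC.
Qed.

Lemma card_edges_reattach H M C :
  (#|edges (reattach H M C)| + \sum_(u in M) #|outer_nbhd H M u|
   = #|edges H| + \sum_(u in M) #|C :\: M|)%N.
Proof.
have card_split K : (#|edges K| = \sum_(u in M) #|outer_nbhd K M u|
    + #|[set e in edges K | ~~ crosses M e]|)%N.
  rewrite -card_crossing_edges -(cardsID [set e | crosses M e]) setIdE.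
  by congr addn; apply: eq_card => e; rewrite !inE andbC.
rewrite !card_split; under eq_bigr => u uM do rewrite outer_nbhd_reattach //.
rewrite addnAC [RHS]addnAC; congr addn; first exact: addnC.
apply: eq_card => e; rewrite !inE.
apply/andP/andP => -[/edgesP[u [v [+ ->]]]];
  rewrite crosses_set2 negb_add mem_edges => + /eqP uv_side;
  by rewrite reattach_same_side // uv_side eqxx.
Qed.

End OuterNeighbourhood.

(** * Interval representations *)

Section IntervalRepresentation.
Variables (R : realDomainType) (T : finType).
Implicit Types (G H : sgraph T) (M C : {set T}) (l r : T -> R).

Definition interval_rep l r H : Prop :=
  (forall v, l v <= r v) /\
  (forall u v, H u v = [&& u != v, l u <= r v & l v <= r u]).

Lemma itv_intersectP (a b c d : R) : a <= b -> c <= d ->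
  (exists x, x \in `[a, b] /\ x \in `[c, d]) <-> (a <= d) && (c <= b).
Proof.
move=> ab cd; split=> [[x []]|/andP[ad cb]].
  rewrite !in_itv /= => /andP[ax xb] /andP[cx xd].
  by rewrite (le_trans ax xd) (le_trans cx xb).
exists (Num.max a c).
by rewrite !in_itv /= !le_max !ge_max !lexx ab cd ad cb orbT.
Qed.

(* For [p <= q] these are the intervals that meet [[p, q]]; for [q < p] they
   are the intervals that contain [[q, p]]. *)
Definition meeting l r (p q : R) : {set T} :=
  [set v | (p <= r v) && (l v <= q)].

Lemma subset_meeting l r p p' q q' :
  p' <= p -> q <= q' -> meeting l r p q \subset meeting l r p' q'.
Proof.
move=> p'p qq'; apply/subsetP => v; rewrite !inE => /andP[pr lq].
by rewrite (le_trans p'p pr) (le_trans lq qq').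
Qed.

Lemma meeting_sub_outer_nbhd H M l r p q u :
  interval_rep l r H -> u \in M -> l u <= p -> q <= r u ->
  meeting l r p q :\: M \subset outer_nbhd H M u.
Proof.
move=> [_ Hlr] uM lup qru; apply/subsetP => v; rewrite !inE Hlr.
case/and3P=> vM pr lq; rewrite vM (le_trans lup pr) (le_trans lq qru) !andbT.
by apply: contraNneq vM => <-.
Qed.

Lemma outer_nbhd_sub_meeting G H M l r :
  interval_rep l r H -> subrel G H -> is_module G M ->
  {in M & &, forall u s t, outer_nbhd G M u \subset meeting l r (l s) (r t)}.
Proof.
move=> [_ Hlr] sGH /is_moduleP eqN u s t uM sM tM; apply/subsetP=> v Nuv.
have meetsM w : w \in M -> [&& w != v, l w <= r v & l v <= r w].
  move=> wM; rewrite -Hlr; apply: sGH.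
  by move: Nuv; rewrite (eqN u w uM wM) inE => /andP[].
rewrite inE; have /and3P[_ -> _] := meetsM s sM.
by have /and3P[_ _ ->] := meetsM t tM.
Qed.

Lemma interval_rep_reattach H M C l r :
  (forall v, l v <= r v) ->
  (forall u v, (u \in M) = (v \in M) ->
     H u v = [&& u != v, l u <= r v & l v <= r u]) ->
  {in M & ~: M, forall u v, (v \in C) = (l u <= r v) && (l v <= r u)} ->
  interval_rep l r (reattach H M C).
Proof.
move=> lr sameE crossE; split=> //; apply: (@sym_crossing_ind _ M).
- by move=> u v; rewrite adj_sym => ->; rewrite eq_sym [_ && (_ <= r v)]andbC.
- by move=> u v uv_side; rewrite reattach_same_side // sameE.
move=> u v uM vM; rewrite reattach_crossing // (crossE u) // (_ : u != v) //.
by move: vM; rewrite inE; apply: contraNneq => <-.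
Qed.

Lemma interval_rep_reattach_clique H M l r p q :
  interval_rep l r H -> {in M &, forall u v, u != v -> H u v} -> p <= q ->
  exists l' r', interval_rep l' r' (reattach H M (meeting l r p q)).
Proof.
move=> [lr Hlr] cliqueM pq.
exists (fun v => if v \in M then p else l v).
exists (fun v => if v \in M then q else r v).
apply: interval_rep_reattach => [v|u v uv_side|u v uM].
- by case: ifP.
- rewrite uv_side; case: ifP => [vM|_]; last exact: Hlr.
  rewrite pq !andbT; have [->|uv] := eqVneq u v; first exact: adj_irr.
  by rewrite cliqueM ?uv_side.
by rewrite inE uM => /negbTE->; rewrite inE.
Qed.

(* The line is cut at [x] and everything to the right of [x] moves by [d];
   the intervals that cover [x] are stretched over the gap. *)
Definition open_gap_left (x d y : R) : R := if y <= x then y else y + d.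
Definition open_gap_right (x d y : R) : R := if x <= y then y + d else y.

Lemma open_gap_le x d y z :
  0 <= d -> (open_gap_left x d y <= open_gap_right x d z) = (y <= z).
Proof.
rewrite /open_gap_left /open_gap_right => d0.
by case: (leP y x) => ?; case: (leP x z) => ?; apply/idP/idP; lra.
Qed.

Lemma interval_rep_reattach_point H M l r x :
  interval_rep l r H ->
  exists l' r', interval_rep l' r' (reattach H M (meeting l r x x)).
Proof.
move=> [lr Hlr].
pose c := \big[Num.max/0]_v Num.max (- l v) (r v).
have c0 : 0 <= c by apply: bigmax_ge_id.
have lr_bd v : - c <= l v /\ r v <= c.
  have : Num.max (- l v) (r v) <= c by apply: le_bigmax.
  by rewrite ge_max lerNl => /andP[].
have d0 : 0 <= 2 * c by lra.
(* The intervals of [M] lie in [[- c, c]]; they fill the gap [[x, x + 2 * c]]. *)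
pose gl := open_gap_left x (2 * c); pose gr := open_gap_right x (2 * c).
exists (fun v => if v \in M then x + c + l v else gl (l v)).
exists (fun v => if v \in M then x + c + r v else gr (r v)).
apply: interval_rep_reattach => [v|u v uv_side|u v uM].
- by case: ifP; rewrite ?lerD2l ?open_gap_le.
- by rewrite uv_side Hlr; case: ifP; rewrite ?lerD2l ?open_gap_le.
rewrite inE uM => /negbTE->; rewrite inE /gl /gr /open_gap_left /open_gap_right.
have [? ?] := lr_bd u; have := lr u; have := lr v => ? ?.
by case: (leP (l v) x) => ?; case: (leP x (r v)) => ?;
  rewrite ?andbF /=; apply/esym; apply/idP/idP => //; lra.
Qed.

End IntervalRepresentation.

Lemma interval_graphP (R : realType) (T : finType) (H : sgraph T) :
  interval_graph R H <-> exists l r : T -> R, interval_rep l r H.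
Proof.
split=> -[l [r [lr Hlr]]]; exists l, r; split=> // u v; last first.
  by rewrite Hlr itv_intersectP // => ->.
have [->|uv] := eqVneq u v; first by rewrite adj_irr.
by apply/idP/idP; rewrite Hlr // itv_intersectP.
Qed.

Lemma ex_argmin_nat (X : Type) (P : X -> Prop) (f : X -> nat) :
  (exists x, P x) -> exists2 x, P x & forall y, P y -> (f x <= f y)%N.
Proof.
move=> [x0 Px0].
have [|_ [[x Px <-] minx]] :=
  @nat_has_minimum (fun n => exists2 x, P x & f x = n).
  by exists (f x0), x0.
by exists x => // y Py; apply: minx; exists y.
Qed.

(** * Minimum interval supergraphs *)

Lemma minimum_card_outer_nbhd (R : realType) (T : finType) (G H : sgraph T)
    (M C : {set T}) :
  minimum_interval_supergraph R G H -> interval_graph R (reattach H M C) ->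
  {in M, forall u, outer_nbhd G M u \subset C} ->
  {in M, forall u, #|C :\: M| <= #|outer_nbhd H M u|}%N ->
  {in M, forall u, #|outer_nbhd H M u| = #|C :\: M|}.
Proof.
move=> [[_ /edges_subP sGH] minH] itvC sNC leC.
have /minH : interval_supergraph R G (reattach H M C).
  by split=> //; apply/edges_subP/subrel_reattach.
rewrite -(leq_add2r (\sum_(u in M) #|outer_nbhd H M u|)) card_edges_reattach.
rewrite leq_add2l => le_sum.
have [ge_sum] := leqif_sum (fun u uM => leqif_eq (leC u uM)).
by rewrite eqn_leq ge_sum le_sum => /esym/forall_inP eqC u /eqC/eqP.
Qed.

Section ModuleOfMinimum.
Variables (R : realType) (T : finType) (G H : sgraph T) (M : {set T}).
Variables (l r : T -> R) (s t : T).
Hypotheses (minH : minimum_interval_supergraph R G H) (modM : is_module G M).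
Hypothesis repH : interval_rep l r H.
Hypotheses (sM : s \in M) (tM : t \in M).
Hypothesis s_max : {in M, forall u, l u <= l s}.
Hypothesis t_min : {in M, forall u, r t <= r u}.

Let sGH : subrel G H.
Proof. by case: minH => [[_ /edges_subP]]. Qed.

Lemma is_module_common_segment : l s <= r t -> is_module H M.
Proof.
move=> st; pose C := meeting l r (l s) (r t).
have cliqueM : {in M &, forall u v, u != v -> H u v}.
  move=> u v uM vM uv; have [_ ->] := repH; rewrite uv /=.
  have := (s_max uM, s_max vM, t_min uM, t_min vM) => -[[[? ?] ?] ?].
  by apply/andP; split; lra.
have CN u : u \in M -> C :\: M \subset outer_nbhd H M u.
  by move=> uM; apply: meeting_sub_outer_nbhd; rewrite ?s_max ?t_min.
have eqN u : u \in M -> outer_nbhd H M u = C :\: M.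
  move=> uM; apply/esym/eqP; rewrite eqEcard CN //=.
  rewrite (minimum_card_outer_nbhd (C := C) minH _ _ _ uM) // => [|w wM|w wM].
  - exact/interval_graphP/interval_rep_reattach_clique.
  - exact: outer_nbhd_sub_meeting sGH modM _ _ _ wM sM tM.
  - exact/subset_leq_card/CN.
by apply/is_moduleP => u v uM vM; rewrite !eqN.
Qed.

Lemma helly_common_point : r t <= l s -> {in M &, forall u v,
  l u <= r v -> l v <= r u ->
  exists y, [/\ r t <= y <= l s, l u <= y <= r u & l v <= y <= r v]}.
Proof.
move=> ts u v uM vM uv vu; have [lr _] := repH.
exists (Num.max (r t) (Num.max (l u) (l v))).
by rewrite !le_max !ge_max !lexx ts !lr uv vu !s_max ?t_min ?orbT.
Qed.

Lemma is_module_separated :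
  induces_connected G M -> r t < l s -> is_module H M.
Proof.
move=> connM ts; have [lr Hlr] := repH.
pose cover y := meeting l r y y.
have [|x /andP[tx xs] x_min] := @ex_argmin_nat R
    (fun y => r t <= y <= l s) (fun y => #|cover y :\: M|).
  by exists (r t); rewrite lexx ltW.
have coverN u y : u \in M -> l u <= y <= r u ->
    cover y :\: M \subset outer_nbhd H M u.
  by move=> uM /andP[? ?]; apply: meeting_sub_outer_nbhd.
have cardN : {in M, forall u, #|outer_nbhd H M u| = #|cover x :\: M|}.
  apply: (minimum_card_outer_nbhd (C := cover x) minH) => [|w wM|w wM].
  - exact/interval_graphP/interval_rep_reattach_point.
  - apply: subset_trans (subset_meeting _ _ xs tx).
    exact: outer_nbhd_sub_meeting sGH modM _ _ _ wM sM tM.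
  have [y [ty wy _]] := helly_common_point (ltW ts) wM wM (lr w) (lr w).
  exact: leq_trans (x_min y ty) (subset_leq_card (coverN w y wM wy)).
have eqN u y : u \in M -> r t <= y <= l s -> l u <= y <= r u ->
    outer_nbhd H M u = cover y :\: M.
  by move=> uM ty uy; apply/esym/eqP; rewrite eqEcard coverN //= cardN ?x_min.
apply/is_moduleP/(induces_connected_const connM) => u v uM vM /sGH.
rewrite Hlr => /and3P[_ uv vu].
have [y [ty uy vy]] := helly_common_point (ltW ts) uM vM uv vu.
by rewrite (eqN u y) ?(eqN v y).
Qed.

End ModuleOfMinimum.

Theorem theorem3 (R : realType) (T : finType) (G : sgraph T) (M : {set T}) :
  connected_module G M ->
  forall H : sgraph T, minimum_interval_supergraph R G H -> is_module H M.
Proof.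
move=> [modM connM] H minH.
have [->|[u uM]] := set_0Vmem M; first by move=> v _; left=> x; rewrite inE.
have [[/interval_graphP[l [r repH]] _] _] := minH.
have [s sM s_max] := arg_maxP l uM.
have [t tM t_min] := arg_minP r uM.
have [st|ts] := leP (l s) (r t).
  exact: (is_module_common_segment minH modM repH sM tM s_max t_min st).
exact: (is_module_separated minH modM repH sM tM s_max t_min connM ts).
Qed.
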